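(* For every $d\in\mathbb N$, there exists a constant $c_d\ge 2$ such that $$\rho(\mathsf T)\le c_d\cdot\omega(\mathsf T)$$ for every complex Hilbert space $\mathcal H$ and every operator $d$-tuple $\mathsf T\in\mathcal B(\mathcal H)^d$, where $\rho(\mathsf T)$ is the Toeplitz modulus and $\omega(\mathsf T)$ is the Toeplitz numerical radius of $\mathsf T$.
   Context: $\mathcal B(\mathcal H)$ is the algebra of bounded operators on the Hilbert space $\mathcal H$. Let $\mathsf T=(T_1,\dots,T_d)\in\mathcal B(\mathcal H)^d$ and $\alpha\in\mathbb R_+=[0,\infty)$. Positive means positive semidefinite. Let $\mathcal T_\alpha$ be the $(d+1)\times(d+1)$ Toeplitz operator matrix on $\bigoplus_1^{d+1}\mathcal H$ whose $(i,j)$ entry is $\alpha 1_{\mathcal H}$ if $i=j$, $T_{i-j}$ if $i>j$, and $T_{j-i}^*$ if $i<j$. The Toeplitz modulus is $\rho(\mathsf T)=\inf\{\alpha\in\mathbb R_+ : \mathcal T_\alpha\text{ is positive}\}$. For $\xi\in\mathcal H$, let $\mathcal T_{\alpha,\xi}$ be the $(d+1)\times(d+1)$ complex Toeplitz matrix whose $(i,j)$ entry is $\alpha$ if $i=j$, $\langle T_{i-j}\xi,\xi\rangle$ if $i>j$, and $\langle T_{j-i}^*\xi,\xi\rangle$ if $i<j$. The Toeplitz numerical radius is $\omega(\mathsf T)=\inf\{\alpha\in\mathbb R_+ : \mathcal T_{\alpha,\xi}\text{ is positive for every unit vector }\xi\in\mathcal H\}$. *)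

(* Defs.v *)
From HB Require Import structures.
From mathcomp Require Import all_boot all_order all_algebra.
From mathcomp Require Import complex.
From mathcomp Require Import boolp classical_sets reals topology normedtype.

Set Implicit Arguments.
Unset Strict Implicit.
Unset Printing Implicit Defensive.

Import Order.TTheory GRing.Theory Num.Theory.
Import numFieldNormedType.Exports.

Local Open Scope classical_set_scope.
Local Open Scope complex_scope.
Local Open Scope ring_scope.

(* Complex Hilbert spaces over R[i]. The form [dotp] is linear in its first
   argument and conjugate-linear in its second one, and it induces the norm. *)
HB.mixin Record isHilbert (R : realType) (H : Type)
    of CompleteNormedModule R[i] H := {
  dotp : {dot H for @Num.conj R[i]} ;
  dotp_norm : forall x : H, dotp x x = `|x| ^+ 2
}.

#[short(type="hilbertType")]
HB.structure Definition Hilbert (R : realType) :=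
  {H of isHilbert R H & CompleteNormedModule R[i] H}.

Record bounded_operator (R : realType) (H : hilbertType R) := BoundedOperator {
  bop_linear :> {linear H -> H} ;
  bop_bounded : exists M : R, forall x : H, `|bop_linear x| <= M%:C * `|x|
}.

(* [adjoint T y] is the unique z with <T x, y> = <x, z> for all x: it exists by
   the Riesz representation theorem, and is unique as the form is definite. *)
Definition adjoint (R : realType) (H : hilbertType R) (T : bounded_operator H)
    (y : H) : H :=
  xget 0 [set z | forall x : H, dotp (T x) y = dotp x z].

(* The (d+1) x (d+1) Toeplitz array with diagonal a, entry t_(i-j) below the
   diagonal and s_(j-i) above it. The tuples (t_1, ..., t_d) and (s_1, ..., s_d)
   are indexed from 0 here, so that t_k is t (k - 1). As 1 <= |i - j| <= d off
   the diagonal, [insub] never returns None there and the default value a of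
   [oapp] is never used. *)
Definition toeplitz (X : Type) (d : nat) (a : X) (t s : 'I_d -> X) :
    'M[X]_d.+1 :=
  \matrix_(i, j)
    if i == j then a
    else if (j < i)%N then oapp t a (insub (i - j).-1)
    else oapp s a (insub (j - i).-1).

(* The inner product and the action of n x n operator matrices on the direct sum
   of n copies of H, whose elements are the functions 'I_n -> H. *)
Definition dsum_dotp (R : realType) (H : hilbertType R) (n : nat)
    (x y : 'I_n -> H) : R[i] :=
  \sum_(i < n) dotp (x i) (y i).

Definition opmx_apply (R : realType) (H : hilbertType R) (n : nat)
    (A : 'M[H -> H]_n) (x : 'I_n -> H) : 'I_n -> H :=
  fun i => \sum_(j < n) A i j (x j).

(* In R[i], 0 <= z means that z is real and nonnegative. *)
Definition opmx_positive (R : realType) (H : hilbertType R) (n : nat)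
    (A : 'M[H -> H]_n) : Prop :=
  forall x : 'I_n -> H, 0 <= dsum_dotp (opmx_apply A x) x.

Definition mx_positive (R : realType) (n : nat) (A : 'M[R[i]]_n) : Prop :=
  forall v : 'cV[R[i]]_n, 0 <= (map_mx Num.conj v^T *m A *m v) 0 0.

Definition toeplitz_opmx (R : realType) (H : hilbertType R) (d : nat)
    (T : 'I_d -> bounded_operator H) (a : R) : 'M[H -> H]_d.+1 :=
  toeplitz (fun x : H => a%:C *: x)
    (fun k => T k : H -> H) (fun k => adjoint (T k)).

Definition toeplitz_mx (R : realType) (H : hilbertType R) (d : nat)
    (T : 'I_d -> bounded_operator H) (a : R) (xi : H) : 'M[R[i]]_d.+1 :=
  toeplitz a%:C
    (fun k => dotp (T k xi) xi) (fun k => dotp (adjoint (T k) xi) xi).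

Definition toeplitz_modulus (R : realType) (H : hilbertType R) (d : nat)
    (T : 'I_d -> bounded_operator H) : R :=
  inf [set a : R | 0 <= a /\ opmx_positive (toeplitz_opmx T a)].

Definition toeplitz_radius (R : realType) (H : hilbertType R) (d : nat)
    (T : 'I_d -> bounded_operator H) : R :=
  inf [set a : R | 0 <= a /\
         forall xi : H, `|xi| = 1 -> mx_positive (toeplitz_mx T a xi)].

(* Main.v *)
(* If a is admissible for the radius, the 2 x 2 minors of the scalar Toeplitz
   matrices give Re (u <T_k x, x>) >= - a |x|^2 for |u| = 1, and polarization with
   the parallelogram law gives 2 Re <T_k x, y> >= - 2 a (|x|^2 + |y|^2). Summing
   these over the pairs of indices shows that a suitable multiple of a is
   admissible for the modulus; the factor 2 d + 2 is enough. *)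

Require Import Defs.
From mathcomp Require Import all_boot all_order all_algebra.
From mathcomp Require Import reals.
From mathcomp Require Import complex ring.
From mathcomp Require Import boolp classical_sets normedtype.

Import Order.TTheory GRing.Theory Num.Theory.
Local Open Scope ring_scope.

(** Used to evaluate quadratic forms at vectors supported on two indices. *)
Lemma sum_two (V : nmodType) (n : nat) (i j : 'I_n) (G : 'I_n -> V) :
  i != j -> (forall l, l != i -> l != j -> G l = 0) ->
  \sum_l G l = G i + G j.
Proof.
move=> ij G0; rewrite (bigD1 i) //= (bigD1 j) ?(eq_sym j) //= big1 ?addr0 //.
by move=> l /andP[li lj]; exact: G0.
Qed.

Arguments sum_two {V n i j G}.

(** * Inner product and polarization *)

Section InnerProduct.
Variables (R : realType) (H : hilbertType R).
Implicit Types (x y z : H) (c : R[i]).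

Lemma dotpDl x y z : dotp (x + y) z = dotp x z + dotp y z.
Proof. exact: linearDl. Qed.

Lemma dotpDr x y z : dotp z (x + y) = dotp z x + dotp z y.
Proof. exact: linearDr. Qed.

Lemma dotpZl c x y : dotp (c *: x) y = c * dotp x y.
Proof. exact: linearZl_LR. Qed.

Lemma dotpZr c x y : dotp x (c *: y) = Num.conj c * dotp x y.
Proof. exact: linearZr_LR. Qed.

Lemma dotpC x y : dotp x y = Num.conj (dotp y x).
Proof. by rewrite (@hermC _ _ _ _ dotp) expr0 mul1r. Qed.

Lemma dotp0l x : dotp (0 : H) x = 0.
Proof. by rewrite -(scale0r (0 : H)) dotpZl mul0r. Qed.

Lemma dotp0r x : dotp x (0 : H) = 0.
Proof. by rewrite dotpC dotp0l rmorph0. Qed.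

Lemma dotp_suml (I : finType) (f : I -> H) y :
  dotp (\sum_i f i) y = \sum_i dotp (f i) y.
Proof.
by elim/big_rec2: _ => [|i a b _ <-]; rewrite ?dotp0l ?dotpDl.
Qed.

Lemma dotp_ge0 x : 0 <= dotp x x.
Proof. by rewrite dotp_norm exprn_ge0. Qed.

Lemma dotp_eq0 x : dotp x x = 0 -> x = 0.
Proof. by rewrite dotp_norm => /eqP; rewrite expf_eq0 /= normr_eq0 => /eqP. Qed.

Lemma unit_scaling x : x != 0 ->
  exists xi : H, `|xi| = 1 /\ x = `|x| *: xi.
Proof.
move=> x0; exists (`|x|^-1 *: x); have nx : `|x| != 0 by rewrite normr_eq0.
by rewrite normrZ normfV normr_id mulVf // scalerA divff // scale1r.
Qed.

(** Both outcomes of [xget] give 0: a chosen z satisfies <z, z> = <T z, 0> = 0, and otherwise the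
    default value 0 is returned. *)
Lemma adjoint0 (T : bounded_operator H) : adjoint T 0 = 0.
Proof.
rewrite /adjoint; apply: dotp_eq0.
case: xgetP => [z _ /(_ z)|]; last by rewrite dotp0l.
by rewrite dotp0r => <-.
Qed.

(** Add the hypotheses at the vectors x + u y for u = 1, -1, i, -i. Since u <T (x + u y), x + u y>
    sums to 4 <T x, y> and |x + u y|^2 sums to 4 (|x|^2 + |y|^2), the total is 4 times the claim. *)
Lemma polarization_bound (T : bounded_operator H) (a : R[i]) :
  (forall u x, u * Num.conj u = 1 ->
     0 <= a * dotp x x + u * dotp (T x) x + Num.conj (u * dotp (T x) x)) ->
  forall x y,
     0 <= a * (dotp x x + dotp y y) + dotp (T x) y + Num.conj (dotp (T x) y).
Proof.
move=> posT x y.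
have ii : 'i * 'i = -1 :> R[i] by rewrite -expr2 sqrCi.
have uN (u : R[i]) : u * Num.conj u = 1 -> - u * Num.conj (- u) = 1.
  by rewrite rmorphN mulrNN.
have u1 : 1 * Num.conj 1 = 1 :> R[i] by rewrite mul1r conjC1.
have ui : 'i * Num.conj 'i = 1 :> R[i] by rewrite conjCi mulrN ii opprK.
have h1 := posT _ (x + 1 *: y) u1.
have h2 := posT _ (x + (- 1) *: y) (uN _ u1).
have h3 := posT _ (x + 'i *: y) ui.
have h4 := posT _ (x + (- 'i) *: y) (uN _ ui).
rewrite -(pmulr_rge0 _ (ltr0n R[i] 4)).
have := addr_ge0 (addr_ge0 h1 h2) (addr_ge0 h3 h4).
congr (0 <= _); rewrite !linearD !linearZ /=.
rewrite !(dotpDl, dotpDr, dotpZl, dotpZr).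
rewrite !(rmorphD, rmorphM, rmorphN, conjC1, conjCi, conjCK) /=.
rewrite !(rmorphN, conjC1, conjCi, conjCK) /= ?conjCi.
move: (dotp (T x) x)^* (dotp (T x) y)^* (dotp (T y) x)^* (dotp (T y) y)^*.
move=> p q r s; move: ('i) ii => I II.
by ring: II.
Qed.

End InnerProduct.

(** * Entries of a Toeplitz array *)

Section Toeplitz.
Variables (d : nat).
Implicit Types (i j : 'I_d.+1) (k : 'I_d).

Lemma toeplitz_diag (X : Type) (a : X) (t s : 'I_d -> X) i :
  toeplitz a t s i i = a.
Proof. by rewrite mxE eqxx. Qed.

Lemma toeplitz_lower (X : Type) (a : X) (t s : 'I_d -> X) i j k :
  i = (j + k).+1 :> nat -> toeplitz a t s i j = t k.
Proof.
move=> ijk; have ji : (j < i)%N by rewrite ijk ltnS leq_addr.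
rewrite mxE -val_eqE (gtn_eqF ji) ji.
by rewrite ijk -addnS addKn /= valK.
Qed.

Lemma toeplitz_upper (X : Type) (a : X) (t s : 'I_d -> X) i j k :
  i = (j + k).+1 :> nat -> toeplitz a t s j i = s k.
Proof.
move=> ijk; have ji : (j < i)%N by rewrite ijk ltnS leq_addr.
rewrite mxE -val_eqE (ltn_eqF ji) ltnNge (ltnW ji) /=.
by rewrite ijk -addnS addKn /= valK.
Qed.

Lemma lower_index i j : (j < i)%N -> {k : 'I_d | i = (j + k).+1 :> nat}.
Proof.
move=> ji; have kd : ((i - j).-1 < d)%N.
  by rewrite prednK ?subn_gt0 // (leq_trans (leq_subr _ _)) // -ltnS.
by exists (Ordinal kd); rewrite -addnS prednK ?subn_gt0 // subnKC // ltnW.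
Qed.

End Toeplitz.
Arguments toeplitz_lower {d X a t s i j k}.
Arguments toeplitz_upper {d X a t s i j k}.
Arguments lower_index {d i j}.

(** * Positivity of operator and scalar Toeplitz matrices *)

Section ToeplitzOperators.
Variables (R : realType) (H : hilbertType R) (d : nat).
Variable T : 'I_d -> bounded_operator H.
Implicit Types (a : R) (x y : H) (k : 'I_d).

Lemma toeplitz_opmx0 a i j : toeplitz_opmx T a i j 0 = 0.
Proof.
have [->|ij] := eqVneq i j; first by rewrite toeplitz_diag scaler0.
have [/lower_index[k ek]|/lower_index[k ek]|e] := ltngtP j i.
- by rewrite (toeplitz_lower ek) linear0.
- by rewrite (toeplitz_upper ek) adjoint0.
- by case/eqP: ij; apply: val_inj.
Qed.

Lemma opmx_quadratic_form n (A : 'M[H -> H]_n) (x : 'I_n -> H) :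
  dsum_dotp (opmx_apply A x) x = \sum_i \sum_j dotp (A i j (x j)) (x i).
Proof. by apply: eq_bigr => i _; rewrite dotp_suml. Qed.

Lemma mx_positiveP n (A : 'M[R[i]]_n) :
  mx_positive A <->
  forall f : 'I_n -> R[i], 0 <= \sum_i \sum_j f j * Num.conj (f i) * A i j.
Proof.
have formE (v : 'cV[R[i]]_n) : (map_mx Num.conj v^T *m A *m v) 0 0 =
    \sum_i \sum_j v j 0 * Num.conj (v i 0) * A i j.
  rewrite mxE exchange_big /=; apply: eq_bigr => j _.
  rewrite mxE mulr_suml; apply: eq_bigr => i _.
  by rewrite !mxE mulrC mulrA.
split=> posA => [f|v]; last by rewrite formE; exact: posA.
have := posA (\col_l f l); rewrite formE; congr (0 <= _).
by apply: eq_bigr => i _; apply: eq_bigr => j _; rewrite !mxE.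
Qed.

Lemma opmx_positive_pair a k :
  opmx_positive (toeplitz_opmx T a) -> forall x y,
  0 <= a%:C%C * (dotp x x + dotp y y) + dotp (T k x) y + dotp (adjoint (T k) y) x.
Proof.
move=> posT x y; pose i : 'I_d.+1 := lift ord0 k; pose j : 'I_d.+1 := ord0.
have ek : i = (j + k).+1 :> nat by [].
have ij : i != j by [].
(* As [lift ord0 k] has value k + 1, the rows and columns 0 and k + 1 meet in [T k] and its
   adjoint. *)
have := posT (fun l => if l == i then y else if l == j then x else 0).
rewrite opmx_quadratic_form (sum_two ij); last first.
  move=> l /negPf-> /negPf->; apply: big1 => m _; exact: dotp0r.
rewrite !(sum_two ij) => [|l /negPf-> /negPf->|l /negPf-> /negPf->];
  rewrite ?toeplitz_opmx0 ?dotp0l //.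
rewrite !eqxx (eq_sym j) (negPf ij) !toeplitz_diag !dotpZl.
rewrite (toeplitz_lower ek) (toeplitz_upper ek).
by congr (0 <= _); ring.
Qed.

(** Test on the vector with entry u at 0 and 1 at k + 1; the diagonal contributes a (|u|^2 + 1) = 2
    a. *)
Lemma mx_positive_pair a k xi :
  mx_positive (toeplitz_mx T a xi) -> forall u : R[i], u * Num.conj u = 1 ->
  0 <= 2 * a%:C%C + u * dotp (T k xi) xi
       + Num.conj u * dotp (adjoint (T k) xi) xi.
Proof.
move=> posT u uu; pose i : 'I_d.+1 := lift ord0 k; pose j : 'I_d.+1 := ord0.
have ek : i = (j + k).+1 :> nat by [].
have ij : i != j by [].
have /mx_positiveP/(_ (fun l =>
  if l == i then 1 else if l == j then u else 0)) := posT.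
rewrite (sum_two ij); last first.
  move=> l /negPf-> /negPf->; apply: big1 => m _.
  by rewrite conjC0 mulr0 mul0r.
rewrite !(sum_two ij) => [|l /negPf-> /negPf->|l /negPf-> /negPf->];
  rewrite ?mul0r //.
rewrite !eqxx (eq_sym j) (negPf ij) !toeplitz_diag.
rewrite (toeplitz_lower ek) (toeplitz_upper ek) uu conjC1.
by congr (0 <= _); ring.
Qed.

(* This replaces the Riesz theorem: the quadratic form of the operator matrix
   must be real at (x, y) and at (i x, y). *)
Lemma opmx_positive_adjoint a k : 0 <= a ->
  opmx_positive (toeplitz_opmx T a) -> forall x y,
  dotp (adjoint (T k) y) x = Num.conj (dotp (T k x) y).
Proof.
move=> a0 posT x y.
have sum_real z : dotp (T k z) y + dotp (adjoint (T k) y) z \is Num.real.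
  have r0 : 0 <= a%:C%C * (dotp z z + dotp y y).
    by rewrite mulr_ge0 ?addr_ge0 ?dotp_ge0 // lecR.
  have := opmx_positive_pair a k posT z y; move: r0; rewrite -addrA.
  set r := _ * _; set s := _ + dotp _ _ => r0 rs.
  by rewrite -(addKr r s) addrC rpredB // ger0_real.
have /CrealP e1 := sum_real x; have /CrealP e2 := sum_real ('i *: x).
move: e1 e2; rewrite linearZ /= !(dotpZl, dotpZr) !(rmorphD, rmorphM) /=.
rewrite conjCi !(rmorphN, conjCi, opprK) /= ?conjCi ?opprK.
set p := dotp _ y; set q := dotp _ x => e1 e2.
(* Divide the reality condition at i x by i. Subtracting it from the one at x isolates 2 q on one
   side and 2 [Num.conj p] on the other. *)
have {}e2 : - Num.conj p + Num.conj q = p - q.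
  by apply: (mulfI (neq0Ci R[i])); rewrite mulrDr mulrN -mulNr e2; ring.
have n2 : (2 : R[i]) != 0 by rewrite pnatr_eq0.
apply: (mulfI n2); have -> : 2 * q = (p + q) - (p - q) by ring.
by rewrite -e1 -e2; ring.
Qed.

(** At the vectors f_i xi the operator form becomes the scalar form at f. This makes the admissible
    set of the radius nonempty as soon as that of the modulus is. *)
Lemma mx_positive_opmx a : 0 <= a ->
  opmx_positive (toeplitz_opmx T a) ->
  forall xi : H, `|xi| = 1 -> mx_positive (toeplitz_mx T a xi).
Proof.
move=> a0 posT xi xi1; apply/mx_positiveP => f.
have := posT (fun i => f i *: xi); rewrite opmx_quadratic_form.
congr (0 <= _); apply: eq_bigr => i _; apply: eq_bigr => j _.
have adjT := opmx_positive_adjoint a _ a0 posT.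
rewrite dotpZr [f j * _]mulrC -mulrA; congr (_ * _).
have [->|ij] := eqVneq i j.
  by rewrite !toeplitz_diag !dotpZl dotp_norm xi1 expr1n mulr1 mulrC.
have [/lower_index[k ek]|/lower_index[k ek]|e] := ltngtP j i.
- by rewrite !(toeplitz_lower ek) linearZ /= dotpZl.
(* Homogeneity of the adjoint comes from [adjT]: the scalar moves to the conjugate-linear slot, and
   the outer conjugation restores it. *)
- by rewrite !(toeplitz_upper ek) !adjT dotpZr rmorphM /= conjCK.
- by case/eqP: ij; apply: val_inj.
Qed.

(** Multiplying the pair inequality at x / |x| by |x|^2 gives the hypothesis of polarization with
    constant 2 a. *)
Lemma mx_positive_bound a k :
  (forall x y, dotp (adjoint (T k) y) x = Num.conj (dotp (T k x) y)) ->
  (forall xi : H, `|xi| = 1 -> mx_positive (toeplitz_mx T a xi)) ->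
  forall x y, 0 <= 2 * a%:C%C * (dotp x x + dotp y y)
                   + dotp (T k x) y + Num.conj (dotp (T k x) y).
Proof.
move=> adjT posT; apply: polarization_bound => u x uu.
have [->|/unit_scaling[xi [xi1 ->]]] := eqVneq x 0.
  by rewrite !dotp0r !mulr0 rmorph0 !addr0.
have := mx_positive_pair a k xi (posT xi xi1) u uu.
rewrite adjT => /(mulr_ge0 (exprn_ge0 2 (normr_ge0 x))).
have nx : Num.conj `|x| = `|x| by apply/CrealP/ger0_real.
have Tx : T k (`|x| *: xi) = `|x| *: T k xi by rewrite linearZ.
congr (0 <= _); rewrite Tx !(dotpZl, dotpZr) [dotp xi xi]dotp_norm xi1.
by rewrite !rmorphM /= !nx; ring.
Qed.

Lemma opmx_positive_mx a : 0 <= a ->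
  (forall k x y, dotp (adjoint (T k) y) x = Num.conj (dotp (T k x) y)) ->
  (forall xi : H, `|xi| = 1 -> mx_positive (toeplitz_mx T a xi)) ->
  opmx_positive (toeplitz_opmx T ((2 * d + 2)%:R * a)).
Proof.
move=> a0 adjT posT x; rewrite opmx_quadratic_form.
set g := fun i j => dotp (toeplitz_opmx T ((2 * d + 2)%:R * a) i j (x j)) (x i).
set A := a%:C%C; have A0 : 0 <= A by rewrite lecR.
have cE : ((2 * d + 2)%:R * a)%:C%C = (2 * d%:R + 2) * A.
  by rewrite rmorphM rmorph_nat natrD natrM.
pose n i := dotp (x i) (x i).
(* [h] charges 2 A (n_i + n_j) to every pair, the diagonal included, so that it sums easily. Hence 4
   d + 8 = 2 (2 d + 2) + 4: twice the diagonal coefficient, plus 4 to refund the charge at i = j. *)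
pose h i j := (if i == j then (4 * d%:R + 8) * A * n i else 0)
              - 2 * A * (n i + n j).
have hg i j : h i j <= g i j + g j i.
  wlog ij : i j / (j <= i)%N.
    move=> hw; have [/hw//|/ltnW/hw] := leqP j i.
    by rewrite /h eq_sym [n j + _]addrC [g j i + _]addrC; case: eqP => // ->.
  rewrite /h /g; have [<-|nij] := eqVneq i j.
    rewrite !toeplitz_diag !dotpZl cE -/(n i).
    by rewrite le_eqVlt; apply/orP; left; apply/eqP; ring.
  have ji : (j < i)%N by rewrite ltn_neqAle ij andbT eq_sym.
  have [k ek] := lower_index ji.
  rewrite (toeplitz_lower ek) (toeplitz_upper ek) adjT sub0r -subr_ge0 opprK.
  have := mx_positive_bound a k (adjT k) posT (x j) (x i).
  by rewrite -/A -/(n i) -/(n j); congr (0 <= _); ring.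
have : \sum_i \sum_j h i j <= \sum_i \sum_j (g i j + g j i).
  by apply: ler_sum => i _; apply: ler_sum => j _; exact: hg.
have -> : \sum_i \sum_j (g i j + g j i) = 2 * \sum_i \sum_j g i j.
  under eq_bigr do rewrite big_split /=.
  by rewrite big_split /= [X in _ + X]exchange_big /= mulr2n mulrDl !mul1r.
have rowE i : \sum_j h i j =
    (4 * d%:R + 8) * A * n i - 2 * A * ((d%:R + 1) * n i + \sum_j n j).
  rewrite big_split /= -big_mkcond /= (big_pred1 i) => [|j]; last first.
    by rewrite eq_sym.
  rewrite sumrN -mulr_sumr big_split /= sumr_const card_ord.
  by rewrite -[n i *+ _]mulr_natl -[d.+1%:R]natr1.
(* The charges total 4 (d + 1) A sum n_i, which leaves 4 d + 8 - 4 (d + 1) = 4. *)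
have -> : \sum_i \sum_j h i j = 4 * A * \sum_i n i.
  rewrite (eq_bigr _ (fun i _ => rowE i)) big_split /= sumrN -!mulr_sumr.
  rewrite big_split /= -mulr_sumr sumr_const card_ord.
  rewrite -[(\sum_j _) *+ _]mulr_natl -[d.+1%:R]natr1.
  by move: (d%:R : R[i]) (\sum_i n i) => D N; ring.
move=> le_sum; rewrite -(pmulr_rge0 _ (ltr0n R[i] 2)); apply: le_trans le_sum.
by rewrite mulr_ge0 ?mulr_ge0 ?sumr_ge0 // => i _; exact: dotp_ge0.
Qed.

End ToeplitzOperators.

Theorem theorem5p12 (R : realType) (d : nat) :
  exists c : R, 2 <= c /\
    forall (H : hilbertType R) (T : 'I_d -> bounded_operator H),
      toeplitz_modulus T <= c * toeplitz_radius T.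
Proof.
(* The summand 2 keeps the constant at least 2 when d = 0. *)
exists (2 * d + 2)%:R; split; first by rewrite ler_nat leq_addl.
move=> H T; rewrite /toeplitz_modulus /toeplitz_radius.
set M := [set a | _]%classic; set W := [set a | _]%classic.
have Wlb : lbound W 0 by move=> a [].
(* The infimum of the empty set is 0. *)
have [M0|/set0P[b [b0 posb]]] := eqVneq M set0.
  rewrite M0 inf0 mulr_ge0 ?ler0n //.
  have [->|/set0P W0] := eqVneq W set0; first by rewrite inf0.
  exact: lb_le_inf.
(* One admissible b for the modulus gives the adjoint identity for every [T k], and below it also
   witnesses that [W] is nonempty. It then suffices that the modulus divided by the constant is a
   lower bound of [W]. *)
have adjT k := opmx_positive_adjoint _ _ _ T b k b0 posb.
have c0 : 0 < (2 * d + 2)%:R :> R by rewrite ltr0n addn2.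
rewrite mulrC -ler_pdivrMr //; apply: lb_le_inf.
  by exists b; split=> //; exact: mx_positive_opmx.
move=> a [a0 posa]; rewrite ler_pdivrMr // mulrC.
apply: ge_inf; first by exists 0 => ? [].
by split; [rewrite mulr_ge0 // ltW | exact: opmx_positive_mx].
Qed.
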